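(* If the positive real numbers $\alpha,\beta,\gamma$ are consecutive terms (in this order) of a geometric progression, then $\alpha^k+\gamma^k\ge 2\beta^k$ for every natural number $k$.
   Context: A real sequence is a geometric progression if there is a fixed real $r$ with $a_{n+1}=r\,a_n$ for all $n$. Natural numbers are the positive integers. *)

(* Defs.v *)
From Stdlib Require Import Reals.
Local Open Scope R_scope.

(* Sequences are indexed from 0: the term [a n] here is a_{n+1} when the index
   set is the positive integers. *)
Definition geometric_progression (a : nat -> R) : Prop :=
  exists r : R, forall n : nat, a (S n) = r * a n.

Definition consecutive_terms_of_gp (x y z : R) : Prop :=
  exists a : nat -> R, geometric_progression a /\
    exists n : nat, a n = x /\ a (S n) = y /\ a (S (S n)) = z.

(* Main.v *)
Require Import Defs.
From Stdlib Require Import Reals.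
From Stdlib Require Import Lra.
Local Open Scope R_scope.

(** With common ratio [r], the difference of the two sides is
    [alpha ^ k * (r ^ k - 1)²], a nonnegative number times a square. *)
Theorem mainTheorem9 (alpha beta gamma : R)
  (alpha_pos : 0 < alpha) (beta_pos : 0 < beta) (gamma_pos : 0 < gamma)
  (Hgp : consecutive_terms_of_gp alpha beta gamma) :
  forall k : nat, (1 <= k)%nat -> alpha ^ k + gamma ^ k >= 2 * beta ^ k.
Proof.
  intros k _.
  destruct Hgp as [a [[r Hr] [n [Ha [Hb Hc]]]]].
  rewrite Hr, Hb in Hc.
  rewrite Hr, Ha in Hb.
  rewrite <- Hc, <- Hb, !Rpow_mult_distr.
  assert (Hk : 0 <= alpha ^ k) by (apply pow_le; lra).
  pose proof (Rmult_le_pos _ _ Hk (Rle_0_sqr (r ^ k - 1))) as Hsq.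
  unfold Rsqr in Hsq.
  lra.
Qed.
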